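(* Let $d\ge 2$ and $a>0$. Define $\lambda_a=\mu_d$ if $a\le a_c^+$ and $\lambda_a=e^{\mathcal{A}^+(a)}$ if $a>a_c^+$, and for $N\ge 1$ let \[ g_N(a,t)=\sum_{n=0}^N \frac{A_n^+(a)}{\lambda_a^n}\, t^n , \] a polynomial of degree $N$ in $t$ with zeros $t_1,\dots,t_N$ (counted with multiplicity). For $\rho\in(0,1)$ let $\nu_N(\rho)=\#\{k : 1-\rho\le |t_k|\le \frac{1}{1-\rho}\}$. Then the zeros of $g_N(a,t)$ converge on the unit circle $|t|=1$ as $N\to\infty$ in the sense that for any $\rho\in(0,1)$ and $\epsilon>0$ there is an $N_0$ such that for all $N\ge N_0$, $\left|1-\frac{1}{N}\nu_N(\rho)\right|<\epsilon$.
   Context: Let $\mathbb{L}^d$ be the $d$-dimensional hypercubic lattice and $\mathbb{L}^d_+$ the half-lattice consisting of vertices with last coordinate $\ge 0$ (and the lattice edges between them); its boundary $\partial\mathbb{L}^d_+$ is the set of vertices with last coordinate $0$. A positive walk is a self-avoiding walk in $\mathbb{L}^d_+$ starting at the origin; its visits are its vertices other than the origin lying in $\partial\mathbb{L}^d_+$. Let $c_n^+(v)$ be the number of positive walks of length $n$ with exactly $v$ visits, and $A_n^+(a)=\sum_{v=0}^n c_n^+(v)a^v$ (the partition function). $\mu_d$ is the growth constant of self-avoiding walks in $\mathbb{L}^d$. For $a>0$ the limit $\mathcal{A}^+(a)=\lim_{n\to\infty}\frac1n\log A_n^+(a)$ exists, and there is a critical value $a_c^+>1$ such that $\mathcal{A}^+(a)=\log\mu_d$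 for $a\le a_c^+$ and $\mathcal{A}^+(a)>\log\mu_d$ for $a>a_c^+$. In particular $A_n^+(a)=\lambda_a^{n+o(n)}$. *)

(* Defs.v *)
From HB Require Import structures.
From mathcomp Require Import all_boot all_order all_algebra.
From mathcomp Require Import all_classical all_reals all_analysis.
From mathcomp.real_closed Require Import complex.
Set Implicit Arguments. Unset Strict Implicit. Unset Printing Implicit Defensive.
Import Order.TTheory GRing.Theory Num.Theory.
Import numFieldNormedType.Exports.
Local Open Scope ring_scope.

Definition vertex (d : nat) := {ffun 'I_d -> int}.

Definition step_vec (d : nat) (s : 'I_d * bool) : vertex d :=
  [ffun i => if i == s.1 then (if s.2 then 1 else -1) else 0].

Definition vadd (d : nat) (x y : vertex d) : vertex d := [ffun i => x i + y i].

Definition origin (d : nat) : vertex d := [ffun => 0].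

(* The vertex sequence w_0 = 0, w_1, ..., w_n of the lattice walk with the
   given sequence of n unit steps.  Every walk of length n in L^d starting at
   the origin arises from exactly one step sequence. *)
Definition walk_vertices (d : nat) (st : seq ('I_d * bool)) : seq (vertex d) :=
  origin d :: scanl (fun x s => vadd x (step_vec s)) (origin d) st.

Definition in_half (d : nat) (x : vertex d) : bool :=
  [forall j : 'I_d, (val j == d.-1)%N ==> (0 <= x j)].
Definition on_boundary (d : nat) (x : vertex d) : bool :=
  [forall j : 'I_d, (val j == d.-1)%N ==> (x j == 0)].

Definition is_saw (d : nat) (st : seq ('I_d * bool)) : bool :=
  uniq (walk_vertices st).

Definition is_positive_walk (d : nat) (st : seq ('I_d * bool)) : bool :=
  is_saw st && all (@in_half d) (walk_vertices st).

Definition visits (d : nat) (st : seq ('I_d * bool)) : nat :=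
  count (@on_boundary d) (behead (walk_vertices st)).

Definition saw_count (d n : nat) : nat :=
  #|[set st : n.-tuple ('I_d * bool) | is_saw st]|.

Definition cplus (d n v : nat) : nat :=
  #|[set st : n.-tuple ('I_d * bool) | is_positive_walk st && (visits st == v)]|.

Definition Aplus_n {R : realType} (d n : nat) (a : R) : R :=
  \sum_(v < n.+1) (cplus d n v)%:R * a ^+ v.

Definition mu {R : realType} (d : nat) : R :=
  limn (fun n : nat => ((saw_count d n)%:R : R) `^ (n%:R^-1)).

Definition Aplus {R : realType} (d : nat) (a : R) : R :=
  limn (fun n : nat => ln (Aplus_n d n a) / n%:R).

(* critical value a_c^+ : A^+(a) = log mu_d exactly for 0 < a <= a_c^+ *)
Definition a_crit {R : realType} (d : nat) : R :=
  sup [set a : R | 0 < a /\ Aplus d a = ln (mu d)].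

Definition lambda {R : realType} (d : nat) (a : R) : R :=
  if a <= a_crit d then mu d else expR (Aplus d a).

Definition gN {R : realType} (d N : nat) (a : R) : {poly R[i]} :=
  \poly_(n < N.+1) ((Aplus_n d n a / lambda d a ^+ n)%:C)%C.

(* the zeros of a complex polynomial, listed with multiplicity *)
Definition zeros {R : realType} (p : {poly R[i]}) : seq R[i] :=
  sval (closed_field_poly_normal p).

Definition nuN {R : realType} (d N : nat) (a rho : R) : nat :=
  count (fun t : R[i] => (((1 - rho)%:C)%C <= `|t|) && (`|t| <= (((1 - rho)^-1)%:C)%C))
        (zeros (gN d N a)).

(* Main.v *)
Require Import Defs.
From HB Require Import structures.
From mathcomp Require Import all_boot all_order all_algebra.
From mathcomp Require Import all_classical all_reals all_analysis.
From mathcomp.real_closed Require Import complex.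
From mathcomp Require Import ring lra zify.
Set Implicit Arguments. Unset Strict Implicit. Unset Printing Implicit Defensive.
Import Order.TTheory GRing.Theory Num.Theory.
Import numFieldNormedType.Exports.
Local Open Scope classical_set_scope.
Local Open Scope ring_scope.

(** Normalised by [lambda_a ^ n], the coefficients of [g_N] are [exp (o(n))].
    Landau's inequality [|c| * prod_k max(1, |t_k|) <= ||g_N||_2] for the leading
    coefficient [c] then gives [|c * g_N(0)| <= q ^ M * ||g_N||_2 ^ 2], where [M]
    is the number of zeros outside the annulus [q <= |t| <= 1 / q]; hence
    [M = o(N)].

    That [A_n^+(a) = lambda_a ^ (n + o(n))] is proved without unfolding walks.
    Let [c_n] count self-avoiding walks and let [D_n] be the supremum, over all
    starting points of the half-space, of the weighted number of half-space
    walks; both are submultiplicative, with growth rates [mu] and [Delta].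
    Cutting at a lowest vertex gives [c_n <= sum_k A_k(1) A_(n-k)(1)], and cutting
    at the first visit gives [D_n <= c_n + a * sum_k c_k A_(n-k)(a)]. Taking [n]
    even and using [A_(i+j)(a) <= A_i(a) D_j], every term is at most
    [A_(n/2)(a)] times the expected exponential factor, which yields the lower
    bounds. Finally [A_n(a)] is nondecreasing in [a] and
    [A_n(a) <= (a / b) ^ n A_n(b)] for [b <= a], so the rate is [mu] up to and
    including [a_c^+]. *)

(** * Landau's inequality *)

Section Landau.
Variable C : numClosedFieldType.
Implicit Types (p f : {poly C}) (z q : C) (s : seq C).

Definition sqnorm n p : C := \sum_(i < n) `|p`_i| ^+ 2.

Lemma sqnorm_ge0 n p : 0 <= sqnorm n p.
Proof. by apply: sumr_ge0 => i _; rewrite exprn_ge0. Qed.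

(** The two factors have equal modulus on the unit circle. Coefficientwise the squared moduli differ
    by [|z|^2 - 1] times [|p_i|^2 - |p_(i-1)|^2], which telescopes; truncating the sum leaves the
    last term as a correction. *)
Lemma sqnorm_mul_linear n p z :
  sqnorm n.+1 (p * ('X - z%:P)) =
  sqnorm n.+1 (p * (1 - (z^*)%:P * 'X)) + (`|z| ^+ 2 - 1) * `|p`_n| ^+ 2.
Proof.
have coefl i : (p * ('X - z%:P))`_i = (if i is j.+1 then p`_j else 0) - p`_i * z.
  by rewrite mulrBr coefB coefMX coefMC; case: i.
have coefr i : (p * (1 - (z^*)%:P * 'X))`_i =
    p`_i - (if i is j.+1 then p`_j else 0) * z^*.
  rewrite mulrBr mulr1 coefB mulrA coefMX; case: i => [|i] /=; first by rewrite mul0r.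
  by rewrite coefMC.
rewrite /sqnorm; elim: n => [|n IHn].
  rewrite !big_ord1 coefl coefr !normCK /= !(rmorphB, rmorphM, rmorph0, conjCK) /=.
  ring.
rewrite big_ord_recr IHn [in RHS]big_ord_recr /=.
set S := \sum_(i < n.+1) _; move: S => S; rewrite coefl coefr.
rewrite !normCK /= !(rmorphB, rmorphM, rmorph0) /= conjCK.
ring.
Qed.

Lemma le_sqnorm m n p : (m <= n)%N -> sqnorm m p <= sqnorm n p.
Proof.
move=> /subnKC <-; rewrite /sqnorm big_split_ord /= lerDl.
by apply: sumr_ge0 => i _; rewrite exprn_ge0.
Qed.

Lemma lead_coef_le_sqnorm n p : (size p <= n)%N -> `|lead_coef p| ^+ 2 <= sqnorm n p.
Proof.
case: (posnP (size p)) => [/eqP|sp] lepn.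
  move: lepn; rewrite size_poly_eq0 => /eqP -> _.
  by rewrite lead_coef0 normr0 expr0n sqnorm_ge0.
apply: le_trans (le_sqnorm p lepn).
rewrite /sqnorm -(prednK sp) big_ord_recr /= lerDr.
by apply: sumr_ge0 => i _; rewrite exprn_ge0.
Qed.

(* Replacing the factor [X - z] by [1 - z^* X] preserves the l2 norm of the
   coefficients and multiplies the leading coefficient by [|z|]. *)
Lemma landau s f n : (size f + size s <= n)%N ->
  (`|lead_coef f| * \prod_(z <- s) (if 1 < `|z| then `|z| else 1)) ^+ 2
  <= sqnorm n (f * \prod_(z <- s) ('X - z%:P)).
Proof.
elim: s f => [|z s IHs] f lefn.
  by rewrite !big_nil !mulr1; apply: lead_coef_le_sqnorm; rewrite addn0 in lefn.
rewrite !big_cons; have [->|f0] := eqVneq f 0.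
  by rewrite lead_coef0 normr0 !mul0r expr0n sqnorm_ge0.
case: ifPn => [z1|_]; last first.
  rewrite mul1r mulrA.
  have -> : `|lead_coef f| = `|lead_coef (f * ('X - z%:P))|.
    by rewrite lead_coefM lead_coefXsubC mulr1.
  by apply: IHs; rewrite size_Mmonic ?monicXsubC // size_XsubC addn2 /= addSnnS.
have z0 : z^* != 0 by rewrite conjC_eq0 -normr_gt0; apply: lt_trans z1.
(* The new factor is a multiple of a linear one with the reflected root, so the induction hypothesis
   applies with it absorbed into [f]. *)
have lc : 1 - (z^*)%:P * 'X = (- z^*) *: ('X - ((z^*)^-1)%:P).
  by rewrite scalerBr scale_polyC mulNr divff // polyCN opprK mul_polyC scaleNr addrC.
have := IHs (f * (1 - (z^*)%:P * 'X)).
rewrite lc -scalerAr lead_coefZ lead_coefM lead_coefXsubC mulr1 normrM normrN norm_conjC.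
rewrite size_scale ?oppr_eq0 // size_Mmonic ?monicXsubC // size_XsubC addn2 /= addSnnS => /(_ lefn).
rewrite scalerAr -lc.
rewrite (mulrC `|z|) -!mulrA => /le_trans; apply.
rewrite le_eqVlt; apply/orP; left; apply/eqP.
have [k def_n] : exists k, n = k.+1.
  by exists n.-1; rewrite prednK // (leq_trans _ lefn) // addnS.
set g := \prod_(w <- s) ('X - w%:P).
(* Here [f * g] has size at most [k], so its coefficient of index [k] vanishes and with it the
   correction term. *)
rewrite (mulrC _ g) (mulrC _ g) !mulrA def_n sqnorm_mul_linear
  nth_default ?normr0 ?expr0n ?mulr0 ?addr0 //.
rewrite (leq_trans (size_polyMleq _ _)) // /g size_prod_XsubC.
by move: lefn; rewrite def_n /= !addnS.
Qed.

Lemma prod_norm_roots p s c : p = c *: \prod_(z <- s) ('X - z%:P) ->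
  `|p`_0| = `|c| * \prod_(z <- s) `|z|.
Proof.
move=> ->; rewrite coefZ normrM -horner_coef0 horner_prod normr_prod.
by congr (_ * _); apply: eq_bigr => z _; rewrite !hornerE normrN.
Qed.

(** Since [|p_0| = |c| prod |z|], Landau's inequality reduces this to single zeros: always
    [|z| <= max(1, |z|)^2], with an extra factor [q] when [|z| < q] or [|z| > 1 / q]. *)
Lemma count_roots_off_annulus p s c q n :
  p = c *: \prod_(z <- s) ('X - z%:P) -> 0 < q -> q < 1 -> (size s < n)%N ->
  `|c| * `|p`_0| <=
    q ^+ count (fun z => ~~ ((q <= `|z|) && (`|z| <= q^-1))) s * sqnorm n p.
Proof.
move=> def_p q0 q1 lesn; rewrite (prod_norm_roots def_p).
have [->|c0] := eqVneq c 0.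
  by rewrite normr0 mul0r mulr_ge0 ?sqnorm_ge0 ?exprn_ge0 // ltW.
have lesn' : (size c%:P + size s <= n)%N by rewrite size_polyC c0 add1n.
have := landau lesn'; rewrite lead_coefC mul_polyC -def_p => lan.
apply: le_trans (ler_wpM2l (exprn_ge0 _ (ltW q0)) lan).
rewrite exprMn [leRHS]mulrCA mulrA -expr2 ler_wpM2l ?exprn_ge0 //.
elim: s {def_p lesn lesn' lan} => [|z s IHs]; first by rewrite !big_nil expr1n mulr1.
rewrite /= !big_cons exprD exprMn mulrACA ler_pM ?prodr_ge0 //.
case: ifPn => z1.
  have -> : (q <= `|z|) = true by rewrite ltW // (lt_trans q1).
  case: (boolP (`|z| <= q^-1)) => /= z2; first by rewrite mul1r expr2 ler_peMl // ltW.
  rewrite expr1 -ler_pdivrMl // expr2 ler_wpM2r //.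
  by rewrite ltW // real_ltNge // ?realV realE ltW.
have {}z1 : `|z| <= 1 by rewrite real_leNgt.
have -> : (`|z| <= q^-1) = true by rewrite (le_trans z1) // ltW // invf_gt1.
rewrite expr1n mulr1 andbT; case: (boolP (q <= `|z|)) => //=; rewrite expr1 => z2.
by rewrite ltW // real_ltNge // realE ltW.
Qed.
End Landau.

(** * Exponential growth rates *)

Section Growth.
Variable R : realType.
Implicit Types (u v : nat -> R) (l s : R).

(* [u n <= l ^ (n + o(n))], [u n >= l ^ (n + o(n))] and [u n = l ^ (n + o(n))]. *)
Definition growth_le u l := forall s, 0 < s -> s < 1 ->
  exists2 K, 0 < K & forall n, s ^+ n * u n <= K * l ^+ n.
Definition growth_ge u l := forall s, 0 < s -> s < 1 ->
  exists2 K, 0 < K & forall n, s ^+ n * l ^+ n <= K * u n.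
Definition growth u l := growth_le u l /\ growth_ge u l.

Lemma growth_bounds u l s : growth u l -> 0 <= l -> (forall n, 0 <= u n) ->
  0 < s -> s < 1 ->
  exists2 K, 0 < K &
    forall n, s ^+ n * u n <= K * l ^+ n /\ s ^+ n * l ^+ n <= K * u n.
Proof.
move=> [gle gge] l0 u0 s0 s1; have [K K0 hK] := gle s s0 s1.
have [L L0 hL] := gge s s0 s1; exists (K + L); first by rewrite addr_gt0.
move=> n; split.
  by apply: le_trans (hK n) _; apply: ler_wpM2r; rewrite ?exprn_ge0 // lerDl ltW.
by apply: le_trans (hL n) _; apply: ler_wpM2r; rewrite // lerDr ltW.
Qed.

(** Used to pay for [k] separate losses [r ^ n] with one allowed loss [s ^ n]. The witness works by
    Bernoulli's inequality. *)
Lemma exists_root_between s k : 0 < s -> s < 1 ->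
  exists r : R, [/\ 0 < r, r < 1 & s <= r ^+ k].
Proof.
move=> s0 s1; exists (1 - (1 - s) / k.+1%:R).
have k0 : 0 < k.+1%:R :> R by rewrite ltr0n.
have ds : (1 - s) / k.+1%:R <= 1 - s by rewrite ler_pdivrMr // ler_peMr ?ler1n // subr_ge0 ltW.
have ds0 : 0 < (1 - s) / k.+1%:R by rewrite divr_gt0 ?subr_gt0.
have kx : k.+1%:R * ((1 - s) / k.+1%:R) = 1 - s by rewrite mulrC divfK // gt_eqF.
move: (_ / _) ds ds0 kx => x ds ds0 kx.
split; [lra|lra|].
have bern m : 1 - m%:R * x <= (1 - x) ^+ m.
  elim: m => [|m IHm]; first by rewrite mul0r subr0 expr0.
  rewrite exprS; have x1 : 0 <= 1 - x by lra.
  apply: le_trans (ler_wpM2l x1 IHm).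
  have : 0 <= m%:R * x ^+ 2 by rewrite mulr_ge0 ?ler0n // exprn_ge0 // ltW.
  rewrite -natr1; nra.
apply: le_trans (bern k).
by move: kx; rewrite -natr1; lra.
Qed.

(** Because [(n + 1) s^n <= 1 + s + ... + s^n <= 1 / (1 - s)]. It absorbs the number of terms of a
    sum into an exponential loss. *)
Lemma succ_mul_exp_le s : 0 < s -> s < 1 ->
  exists2 K : R, 0 < K & forall n, n.+1%:R * s ^+ n <= K.
Proof.
move=> s0 s1; exists (1 - s)^-1; first by rewrite invr_gt0 subr_gt0.
move=> n; rewrite -[leRHS]mul1r ler_pdivlMr ?subr_gt0 //.
suff : n.+1%:R * s ^+ n * (1 - s) <= 1 - s ^+ n.+1.
  by move=> /le_trans; apply; rewrite gerBl exprn_ge0 // ltW.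
elim: n => [|n IHn]; first by rewrite expr0 expr1 mulr1 mul1r.
have y1 : s ^+ n.+1 <= 1 by rewrite exprn_ile1 ?ltW.
have -> : n.+2%:R * s ^+ n.+1 * (1 - s) =
    s * (n.+1%:R * s ^+ n * (1 - s)) + s ^+ n.+1 * (1 - s).
  by rewrite -(natr1 n.+1) exprS; ring.
have := ler_wpM2l (ltW s0) IHn; rewrite (exprS s n.+1).
move: (s ^+ n.+1) y1 => y y1 h.
have : 0 <= (1 - y) * (1 - s) by rewrite mulr_ge0 // subr_ge0 // ltW.
nra.
Qed.

Lemma exp_lt1_small s K : 0 <= s -> s < 1 ->
  exists N0 : nat, forall n, (N0 <= n)%N -> K * s ^+ n < 1.
Proof.
move=> s0 s1.
have : (fun n => K * s ^+ n) @ \oo --> (K * 0 : R).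
  by apply: cvgMr; apply: cvg_expr; rewrite ger0_norm.
rewrite mulr0 => /cvgr_lt /(_ 1 ltr01) [N0 _ h].
by exists N0 => n /h.
Qed.

Lemma growth_scale u l : 0 < l -> growth u l -> growth (fun n => u n / l ^+ n) 1.
Proof.
move=> l0 [gle gge]; split=> s s0 s1.
  have [K K0 h] := gle s s0 s1; exists K => // n.
  by rewrite expr1n mulr1 mulrA ler_pdivrMr ?exprn_gt0.
have [K K0 h] := gge s s0 s1; exists K => // n.
by rewrite expr1n mulr1 mulrA ler_pdivlMr ?exprn_gt0.
Qed.

Lemma growth_le_mono u v l : (forall n, u n <= v n) -> growth_le v l -> growth_le u l.
Proof.
move=> uv gv s s0 s1; have [K K0 h] := gv s s0 s1; exists K => // n.
by apply: le_trans (h n); apply: ler_wpM2l; rewrite // exprn_ge0 // ltW.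
Qed.

Lemma growth_le_exp_mul u l c : 0 <= c -> growth_le u l ->
  growth_le (fun n => c ^+ n * u n) (c * l).
Proof.
move=> c0 gu s s0 s1; have [K K0 h] := gu s s0 s1; exists K => // n.
by rewrite mulrCA exprMn [leRHS]mulrCA ler_wpM2l ?exprn_ge0.
Qed.

(** If [l < m], choose [s < 1] with [l / m <= s^3]. The two bounds give
    [s^(2n) m^n <= K L l^n <= K L s^(3n) m^n], so [1 <= K L s^n] for all [n], which is absurd. *)
Lemma growth_rate_le u l m : 0 < l -> 0 < m -> growth_le u l -> growth_ge u m -> m <= l.
Proof.
move=> l0 m0 gl gm; rewrite leNgt; apply/negP => lm.
have lm1 : l / m < 1 by rewrite ltr_pdivrMr ?mul1r.
have lm0 : 0 < l / m by rewrite divr_gt0.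
have [s [s0 s1 hs]] := exists_root_between 3 lm0 lm1.
have [K K0 hK] := gl s s0 s1; have [L L0 hL] := gm s s0 s1.
have [N0 /(_ N0 (leqnn _))] := exp_lt1_small (K * L) (ltW s0) s1.
have h1 := hK N0; have h2 := hL N0.
apply/negP; rewrite -leNgt.
have mN : 0 < m ^+ N0 by rewrite exprn_gt0.
have sN : 0 < s ^+ N0 by rewrite exprn_gt0.
have h3 : l ^+ N0 <= s ^+ N0 ^+ 3 * m ^+ N0.
  have lsm : l <= s ^+ 3 * m by rewrite -ler_pdivrMr.
  by rewrite -exprM mulnC exprM -exprMn lerXn2r // nnegrE ?mulr_ge0 ?exprn_ge0 ?ltW.
have h4 : s ^+ N0 * (s ^+ N0 * m ^+ N0) <= L * K * (s ^+ N0 ^+ 3 * m ^+ N0).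
  apply: le_trans (ler_wpM2l (ltW sN) h2) _; rewrite mulrCA -mulrA (ler_wpM2l (ltW L0)) //.
  by apply: le_trans h1 _; rewrite ler_wpM2l // ltW.
move: h4; rewrite !mulrA ler_pM2r // -subr_ge0 => h5.
have : 0 <= s ^+ N0 * s ^+ N0 * (K * L * s ^+ N0 - 1) by apply: le_trans h5 _; lra.
by rewrite pmulr_rge0 ?mulr_gt0 // subr_ge0.
Qed.

Lemma growth_ln u l : 0 < l -> (forall n, 0 < u n) -> growth u l ->
  (fun n => ln (u n) / n%:R) @ \oo --> ln l.
Proof.
move=> l0 u0 gu; apply/cvgrPdist_le => e e0.
(* With [s = exp (- e / 2)], the logarithm of the loss [s ^ n] takes half of the tolerance [e * n];
   the constant [ln K] fits in the other half for large [n]. *)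
have s1 : expR (- (e / 2)) < 1 by rewrite expR_lt1 oppr_lt0 divr_gt0.
have [K K0 h] := growth_bounds gu (ltW l0) (fun n => ltW (u0 n)) (expR_gt0 _) s1.
set k := ln K.
near=> n.
have n0 : (0 < n)%N by near: n; exists 1%N.
have nR : 0 < n%:R :> R by rewrite ltr0n.
have kn : `|k| <= e / 2 * n%:R.
  near: n; exists (Num.truncn (`|k| / (e / 2))).+1 => // n /= hn.
  rewrite -ler_pdivrMl ?divr_gt0 // mulrC.
  by apply: le_trans (ltW (truncnS_gt _)) _; rewrite ler_nat.
have [h1 h2] := h n.
have ln_n : l ^+ n = expR (n%:R * ln l) by rewrite expRM_natl lnK.
rewrite ln_n -expRM_natl -(lnK (u0 n : u n \is Num.pos)) -(lnK (K0 : K \is Num.pos))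
  -/k -!expRD ler_expR in h1.
rewrite ln_n -expRM_natl -(lnK (u0 n : u n \is Num.pos)) -(lnK (K0 : K \is Num.pos))
  -/k -!expRD ler_expR in h2.
have -> : ln l - ln (u n) / n%:R = (n%:R * ln l - ln (u n)) / n%:R.
  by rewrite mulrBl mulrAC divff ?mul1r // gt_eqF.
rewrite normrM normfV (gtr0_norm nR) ler_pdivrMr //.
move: h1 h2 kn; rewrite !ler_norml !mulrN; set U := ln (u n); set L := ln l.
by move=> ? ? /andP[? ?]; apply/andP; split; lra.
Unshelve. all: by end_near. Qed.

(** From [u (2 j) >= l^(2j)] and [u (2 j) <= l^j v_j], up to subexponential factors, one [l^j]
    cancels. The exponent 3 below counts the losses: two from [u] at length [2 j], one from the
    hypothesis. *)
Lemma growth_ge_of_double u v l : 0 < l -> growth_ge u l -> (forall n, 0 <= v n) ->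
  (forall r, 0 < r -> r < 1 -> exists2 K, 0 < K &
     forall j, r ^+ j * u (2 * j)%N <= K * (l ^+ j * v j)) ->
  growth_ge v l.
Proof.
move=> l0 gu v0 huv s s0 s1; have [r [r0 r1 sr]] := exists_root_between 3 s0 s1.
have [K K0 hK] := gu r r0 r1; have [L L0 hL] := huv r r0 r1.
exists (K * L) => [|j]; first exact: mulr_gt0.
have lj : 0 < l ^+ j by rewrite exprn_gt0.
have rj : 0 <= r ^+ j by rewrite exprn_ge0 // ltW.
apply: le_trans (_ : r ^+ j ^+ 3 * l ^+ j <= _).
  rewrite -exprM mulnC exprM (ler_wpM2r (ltW lj)) //.
  by rewrite lerXn2r // nnegrE ?exprn_ge0 // ltW.
rewrite -(ler_pM2l lj); apply: le_trans (_ : r ^+ j * (K * u (2 * j)%N) <= _).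
  apply: le_trans (ler_wpM2l rj (hK (2 * j)%N)).
  by rewrite [(2 * j)%N]mulnC !exprM; rewrite le_eqVlt; apply/orP; left; apply/eqP; ring.
rewrite mulrCA -mulrA [leRHS]mulrCA (ler_wpM2l (ltW K0)) //.
by rewrite [leRHS]mulrCA; apply: hL.
Qed.

Lemma growth_root u l : 0 < l -> (forall n, 0 < u n) -> growth u l ->
  (fun n => u n `^ n%:R^-1) @ \oo --> l.
Proof.
move=> l0 u0 gu.
have -> : (fun n => u n `^ n%:R^-1) = expR \o (fun n => ln (u n) / n%:R).
  by apply/funext => n /=; rewrite /powR gt_eqF // mulrC.
rewrite -(lnK (l0 : l \is Num.pos)).
apply: continuous_cvg; first exact: continuous_expR.
exact: growth_ln.
Qed.

(* Fekete's lemma: [l] is the infimum of the geometric rates bounding [u]. *)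
Lemma submultiplicative_growth u : (forall n, 1 <= u n) ->
  u 0%N = 1 -> (forall m n, u (m + n)%N <= u m * u n) ->
  exists2 l, 0 < l & growth u l.
Proof.
move=> u1 u00 usub.
have u0 n : 0 < u n by apply: lt_le_trans (u1 n).
pose E := [set t : R | 0 < t /\ exists2 K, 0 < K & forall n, u n <= K * t ^+ n]%classic.
have E1 t : E t -> 1 <= t.
  move=> [t0 [K K0 hK]]; rewrite leNgt; apply/negP => t1.
  have [N0 /(_ N0 (leqnn _))] := exp_lt1_small K (ltW t0) t1.
  by apply/negP; rewrite -leNgt (le_trans (u1 N0)).
have uq m q : u (q * m)%N <= u m ^+ q.
  elim: q => [|q IHq]; first by rewrite mul0n u00 expr0.
  by rewrite mulSn exprS (le_trans (usub _ _)) // ler_wpM2l // ltW.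
have Eu : E (u 1%N).
  split=> //; exists 1 => // n; rewrite mul1r.
  by rewrite -{1}(muln1 n) uq.
have Einf : has_inf E.
  by split; [exists (u 1%N)|exists 1 => t /E1].
have l1 : 1 <= inf E by apply: lb_le_inf; [exists (u 1%N)|exact: E1].
have l0 : 0 < inf E by apply: lt_le_trans l1.
exists (inf E) => //; split=> s s0 s1.
  have [t [[t0 [K K0 hK]] tlt]] : exists t, E t /\ t < inf E / s.
    have e0 : 0 < inf E / s - inf E by rewrite subr_gt0 ltr_pdivlMr // gtr_pMr.
    have [t Et tlt] := inf_adherent e0 Einf.
    by exists t; split=> //; move: tlt; rewrite addrC subrK.
  exists K => // n; apply: le_trans (_ : s ^+ n * (K * t ^+ n) <= _).
    by apply: ler_wpM2l; [rewrite exprn_ge0 // ltW | exact: hK].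
  have tsl : s * t <= inf E by rewrite mulrC -ler_pdivlMr // ltW.
  rewrite mulrCA -exprMn (ler_wpM2l (ltW K0)) //.
  by rewrite lerXn2r // nnegrE ?mulr_ge0 // ltW.
exists 1 => // n; rewrite -exprMn mul1r leNgt; apply/negP => un.
have sl0 : 0 < s * inf E by rewrite mulr_gt0.
have n0 : (0 < n)%N by case: n un => //; rewrite u00 expr0 ltxx.
(* A single length [n] with [u n < (s * inf E) ^ n] makes [s * inf E] a rate for all lengths: write
   [m = q n + r], and let [M] dominate the contributions of all remainders [r]. This contradicts the
   infimum. *)
have /ge_inf : E (s * inf E).
  split=> //.
  pose M := \sum_(r < n) u r / (s * inf E) ^+ r.
  have term0 r : 0 < u r / (s * inf E) ^+ r by rewrite divr_gt0 ?exprn_gt0.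
  exists M.
    rewrite /M; case: n n0 {un M} => // n _.
    by rewrite big_ord_recl ltr_pwDl // sumr_ge0 // => i _; rewrite ltW.
  move=> m; rewrite (divn_eq m n) exprD mulrA.
  apply: le_trans (usub _ _) _.
  rewrite [leRHS]mulrAC mulrC; apply: ler_pM; [exact/ltW|exact/ltW| |].
    rewrite -ler_pdivrMr ?exprn_gt0 //.
    rewrite /M (bigD1 (Ordinal (ltn_pmod m n0))) //= lerDl sumr_ge0 // => i _.
    by rewrite ltW.
  apply: le_trans (uq _ _) _.
  by rewrite mulnC exprM lerXn2r // ?nnegrE ?exprn_ge0 // ltW.
have /[swap] /[apply] : has_lbound E by case: Einf.
by rewrite leNgt gtr_pMl // s1.
Qed.

End Growth.

(** * Zeros of polynomials with subexponential coefficients *)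

Section Zeros.
Variable R : realType.
Local Notation "x %:C" := (x%:C)%C.

Definition in_annulus (q : R) (t : R[i]) := (q%:C <= `|t|) && (`|t| <= (q^-1)%:C).

Lemma normc_real_nneg (x : R) : 0 <= x -> `|x%:C| = x%:C.
Proof. by move=> x0; rewrite ger0_norm // ler0c. Qed.

Lemma zeros_off_annulus_le (b : nat -> R) (q : R) N :
  (forall n, 0 < b n) -> 0 < q -> q < 1 ->
  let p := \poly_(n < N.+1) (b n)%:C in
  size (zeros p) = N /\
  b N * b 0%N <= q ^+ (N - count (in_annulus q) (zeros p)) * \sum_(i < N.+1) b i ^+ 2.
Proof.
move=> b0 q0 q1 p; rewrite /zeros; case: closed_field_poly_normal => zs /= def_p.
have gt0C x : 0 < x -> 0 < x%:C by rewrite -ltcR.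
have bN : (b N)%:C != 0 by rewrite gt_eqF // gt0C.
have lead_p : lead_coef p = (b N)%:C by rewrite lead_coef_poly.
have szs : size zs = N.
  have : size p = N.+1 by rewrite size_poly_eq.
  rewrite def_p size_scale ?lead_p // size_prod_XsubC; by case.
split=> //.
have qC0 : 0 < q%:C by rewrite gt0C.
have qC1 : q%:C < 1 by rewrite -[1]/(1%:C) ltcR.
have := @count_roots_off_annulus _ p zs _ q%:C N.+1 def_p qC0 qC1.
rewrite szs => /(_ (ltnSn _)).
have -> : count (fun z => ~~ ((q%:C <= `|z|) && (`|z| <= q%:C^-1))) zs =
    (N - count (in_annulus q) zs)%N.
  apply/eqP; rewrite -(eqn_add2l (count (in_annulus q) zs)) subnKC; last first.
    by rewrite -szs count_size.
  rewrite -szs -(count_predC (in_annulus q)) eqn_add2l; apply/eqP.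
  by apply: eq_count => z /=; rewrite /in_annulus fmorphV.
have -> : sqnorm N.+1 p = (\sum_(i < N.+1) b i ^+ 2)%:C.
  rewrite /sqnorm rmorph_sum; apply: eq_bigr => i _.
  by rewrite coef_poly ltn_ord normc_real_nneg ?ltW // rmorphXn.
rewrite lead_p coef_poly /= !normc_real_nneg 1?[0 <= b _]ltW //.
by rewrite -rmorphXn -!rmorphM lecR.
Qed.

(** If at least [eps * N] zeros lie off the annulus, then [N <= k (N - nu)] because [k * eps >= 1].
    The [k]-th power of the Landau bound then yields [r^N <= M^k q^N <= M^k r^(2N)], which fails for
    large [N]. *)
Lemma zeros_near_circle (b : nat -> R) (q eps : R) :
  (forall n, 0 < b n) -> growth b 1 -> 0 < q -> q < 1 -> 0 < eps ->
  exists N0 : nat, (1 <= N0)%N /\ forall N : nat, (N0 <= N)%N ->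
    `|1 - (count (in_annulus q) (zeros (\poly_(n < N.+1) (b n)%:C)))%:R / N%:R| < eps.
Proof.
move=> b0 gb q0 q1 eps0.
pose k := (Num.truncn eps^-1).+1.
have keps : 1 <= k%:R * eps.
  by rewrite -ler_pdivrMr // mul1r; apply/ltW/truncnS_gt.
have [r [r0 r1 qr]] := exists_root_between 2 q0 q1.
have [s [s0 s1 sr]] := exists_root_between (4 * k) r0 r1.
have [K K0 hK] := growth_bounds gb ler01 (fun n => ltW (b0 n)) s0 s1.
have [L L0 hL] := succ_mul_exp_le s0 s1.
pose M := K ^+ 3 * L / b 0%N.
have M0 : 0 < M by rewrite divr_gt0 // mulr_gt0 // exprn_gt0.
have [N0 hN0] := exp_lt1_small (M ^+ k) (ltW r0) r1.
exists N0.+1; split=> // N ltN.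
have N_gt0 : (0 < N)%N by apply: leq_ltn_trans ltN.
have [] := zeros_off_annulus_le N b0 q0 q1.
set zs := zeros _ => szs hb.
set nu := count _ _ in hb *.
have nuN : (nu <= N)%N by rewrite -szs count_size.
have NR : 0 < N%:R :> R by rewrite ltr0n.
have -> : 1 - nu%:R / N%:R = (N - nu)%:R / N%:R :> R.
  by rewrite natrB // mulrBl divff // gt_eqF.
rewrite ger0_norm ?divr_ge0 // ltr_pdivrMr // ltNge; apply/negP => bad.
have Nk : (N <= k * (N - nu))%N.
  rewrite -(ler_nat R) natrM; apply: le_trans (_ : k%:R * (eps * N%:R) <= _).
    by rewrite mulrA ler_peMl // ltW.
  by rewrite ler_wpM2l.
have sN : 0 < s ^+ N by rewrite exprn_gt0.
(* Of the four factors [s ^ N], one bounds [b N] from below, two bound the squares [b i ^ 2] from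
   above, and one absorbs the [N + 1] summands. *)
have key : s ^+ (4 * N) <= M * q ^+ (N - nu).
  have sum_le : s ^+ N ^+ 3 * \sum_(i < N.+1) b i ^+ 2 <= K ^+ 2 * L.
    apply: le_trans (_ : s ^+ N * (K ^+ 2 *+ N.+1) <= _).
      rewrite exprS -mulrA (ler_wpM2l (ltW sN)) // mulr_sumr.
      rewrite -[N.+1 in leRHS]card_ord -sumr_const ler_sum // => i _.
      rewrite -exprMn lerXn2r // ?nnegrE ?mulr_ge0 // ?(ltW sN) ?(ltW K0) ?(ltW (b0 i)) //.
      have [+ _] := hK i; rewrite expr1n mulr1; apply: le_trans.
      by rewrite (ler_wpM2r (ltW (b0 i))) // ler_wiXn2l ?(ltW s0) ?(ltW s1) // -ltnS.
    rewrite -mulr_natr mulrCA ler_wpM2l ?exprn_ge0 ?(ltW K0) // mulrC; exact: hL.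
  have [_ hN] := hK N; rewrite expr1n mulr1 in hN.
  rewrite /M mulrAC ler_pdivlMr // mulnC exprM.
  rewrite exprS mulrAC.
  apply: le_trans (_ : K * b N * b 0%N * s ^+ N ^+ 3 <= _).
    have s3 : 0 <= s ^+ N ^+ 3 by rewrite exprn_ge0 // ltW.
    by rewrite (ler_wpM2r s3) // (ler_wpM2r (ltW (b0 0%N))).
  rewrite [K ^+ 3]exprS -!mulrA (ler_wpM2l (ltW K0)) // mulrA.
  have s3 : 0 <= s ^+ N ^+ 3 by rewrite exprn_ge0 // ltW.
  apply: le_trans (ler_wpM2r s3 hb) _.
  have qe : 0 <= q ^+ (N - nu) by rewrite exprn_ge0 // ltW.
  rewrite -mulrA; apply: le_trans (_ : q ^+ (N - nu) * (K ^+ 2 * L) <= _).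
    by rewrite (ler_wpM2l qe) // mulrC.
  by rewrite mulrC expr2 !mulrA.
have q01 : 0 <= q <= 1 by rewrite !ltW.
have : r ^+ N <= M ^+ k * q ^+ N.
  apply: le_trans (_ : M ^+ k * q ^+ (k * (N - nu)) <= _); last first.
    by rewrite ler_wpM2l ?exprn_ge0 ?(ltW M0) // ler_wiXn2l // ltW.
  rewrite mulnC exprM -exprMn.
  apply: le_trans (_ : (s ^+ (4 * N)) ^+ k <= _).
    by rewrite -exprM mulnAC exprM lerXn2r // ?nnegrE ?exprn_ge0 // ltW.
  have s4 : 0 <= s ^+ (4 * N) by rewrite exprn_ge0 // ltW.
  by rewrite lerXn2r // nnegrE // (le_trans s4).
apply/negP; rewrite -ltNge.
apply: le_lt_trans (_ : M ^+ k * (r ^+ 2) ^+ N < _).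
  by rewrite ler_wpM2l ?exprn_ge0 ?(ltW M0) // lerXn2r // ?nnegrE ?exprn_ge0 // ltW.
rewrite -exprM mulnC exprM expr2 mulrA gtr_pMl ?exprn_gt0 //.
by apply: hN0; apply: ltnW.
Qed.
End Zeros.

(** * Walks *)

Section TupleSums.
Variables (R : numDomainType) (T : finType).
Implicit Types (F G : seq T -> R).

(** Summands are functions of plain sequences, so that cutting a word at any position needs no casts
    between tuple types. *)
Fixpoint tsum n F : R :=
  if n is m.+1 then \sum_(x : T) tsum m (fun t => F (x :: t)) else F [::].

Lemma tsumE n F : tsum n F = \sum_(t : n.-tuple T) F t.
Proof.
elim: n F => [|n IHn] F /=.
  by rewrite (big_pred1 [tuple]) // => t; rewrite [t]tuple0 /= eqxx.
under eq_bigr do rewrite IHn.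
rewrite pair_big /= (reindex (fun t : n.+1.-tuple T => (thead t, [tuple of behead t]))) /=.
  by apply: eq_bigr => t _; rewrite {3}(tuple_eta t).
exists (fun p : T * n.-tuple T => [tuple of p.1 :: p.2]) => [t _|[x t] _] /=.
  by rewrite [RHS]tuple_eta; apply: val_inj.
by congr (_, _); apply: val_inj.
Qed.

Lemma eq_tsum n F G : (forall t, size t = n -> F t = G t) -> tsum n F = tsum n G.
Proof. by move=> FG; rewrite !tsumE; apply: eq_bigr => t _; rewrite FG // size_tuple. Qed.

Lemma ler_tsum n F G : (forall t, size t = n -> F t <= G t) -> tsum n F <= tsum n G.
Proof. by move=> FG; rewrite !tsumE; apply: ler_sum => t _; rewrite FG // size_tuple. Qed.

Lemma tsum_ge0 n F : (forall t, 0 <= F t) -> 0 <= tsum n F.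
Proof. by move=> F0; rewrite tsumE; apply: sumr_ge0. Qed.

Lemma tsum_mull n F c : tsum n (fun t => c * F t) = c * tsum n F.
Proof. by rewrite !tsumE mulr_sumr. Qed.

Lemma tsum_mulr n F c : tsum n (fun t => F t * c) = tsum n F * c.
Proof. by rewrite !tsumE mulr_suml. Qed.

Lemma tsumD n F G : tsum n (fun t => F t + G t) = tsum n F + tsum n G.
Proof. by rewrite !tsumE big_split. Qed.

Lemma tsum_exchange n m (H : 'I_m -> seq T -> R) :
  tsum n (fun t => \sum_(k < m) H k t) = \sum_(k < m) tsum n (H k).
Proof. by rewrite tsumE exchange_big; apply: eq_bigr => k _; rewrite tsumE. Qed.

Lemma tsum_cat m n F : tsum (m + n) F = tsum m (fun s => tsum n (fun t => F (s ++ t))).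
Proof. by elim: m F => [|m IHm] F //=; apply: eq_bigr => x _; rewrite IHm. Qed.

Lemma tsum_take_drop k n F G : (k <= n)%N ->
  tsum n (fun t => F (take k t) * G (drop k t)) = tsum k F * tsum (n - k) G.
Proof.
move=> kn; rewrite -{1}(subnKC kn) tsum_cat -tsum_mulr.
apply: eq_tsum => s sk; rewrite -tsum_mull; apply: eq_tsum => t _.
by rewrite -sk take_size_cat // drop_size_cat.
Qed.

Lemma tsum_rcons n F : tsum n.+1 F = \sum_(x : T) tsum n (fun t => F (rcons t x)).
Proof.
rewrite -addn1 tsum_cat /= tsumE exchange_big /=; apply: eq_bigr => x _.
by rewrite tsumE; apply: eq_bigr => t _; rewrite cats1.
Qed.

(** Reversal combined with an involution of the letters permutes the words of length [n]; for walks
    this is reversal of time. *)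
Lemma tsum_rev_map n F (g : T -> T) : involutive g ->
  tsum n (fun t => F (rev (map g t))) = tsum n F.
Proof.
move=> gK; elim: n F => [|n IHn] F //.
rewrite [RHS]tsum_rcons [RHS](reindex g) /=; last by exists g => x _; rewrite gK.
apply: eq_bigr => x _; rewrite -[RHS]IHn; apply: eq_tsum => t _.
by rewrite rev_cons.
Qed.
End TupleSums.

(** * Cutting, reversing and translating lattice walks *)

Section Walks.
Variable d : nat.
Local Notation V := (vertex d.+1).
Local Notation step := ('I_d.+1 * bool)%type.
Implicit Types (x y v : V) (st s t : seq step).

Definition ht v : int := v ord_max.

Lemma htD x y : ht (x + y) = ht x + ht y.
Proof. by rewrite /ht ffunE. Qed.

Lemma in_halfE v : in_half v = (0 <= ht v).
Proof.
apply/forallP/idP => [/(_ ord_max)|v0 j]; first by rewrite /= eqxx.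
by apply/implyP => /eqP jd; have -> : j = ord_max by apply: val_inj.
Qed.

Lemma on_boundaryE v : on_boundary v = (ht v == 0).
Proof.
apply/forallP/idP => [/(_ ord_max)|v0 j]; first by rewrite /= eqxx.
by apply/implyP => /eqP jd; have -> : j = ord_max by apply: val_inj.
Qed.

Lemma vaddE x y : vadd x y = x + y.
Proof. by apply/ffunP => i; rewrite !ffunE. Qed.

Lemma originE : origin d.+1 = 0.
Proof. by apply/ffunP => i; rewrite !ffunE. Qed.

Fixpoint walk_from x st : seq V :=
  x :: (if st is s :: st' then walk_from (x + step_vec s) st' else [::]).

Fixpoint endpoint x st : V :=
  if st is s :: st' then endpoint (x + step_vec s) st' else x.

(** The final vertex is omitted so that, in a concatenation, the junction appears only in the second
    piece. *)
Fixpoint walk_init x st : seq V :=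
  if st is s :: st' then x :: walk_init (x + step_vec s) st' else [::].

Lemma walk_verticesE st : walk_vertices st = walk_from 0 st.
Proof.
rewrite /walk_vertices originE; elim: st 0 => //= s st IHst x.
by rewrite vaddE IHst.
Qed.

Lemma walk_from_rcons x s : walk_from x s = rcons (walk_init x s) (endpoint x s).
Proof. by elim: s x => //= s st IHst x; rewrite IHst. Qed.

Lemma walk_from_cat x s t :
  walk_from x (s ++ t) = walk_init x s ++ walk_from (endpoint x s) t.
Proof. by elim: s x => //= s st IHst x; rewrite IHst. Qed.

Lemma walk_from_cat_behead x s t :
  walk_from x (s ++ t) = walk_from x s ++ behead (walk_from (endpoint x s) t).
Proof. by rewrite walk_from_cat [walk_from x s]walk_from_rcons cat_rcons; case: t. Qed.

Lemma endpoint_cat x s t : endpoint x (s ++ t) = endpoint (endpoint x s) t.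
Proof. by elim: s x => /=. Qed.

Lemma walk_from_add y x s : walk_from (x + y) s = [seq v + y | v <- walk_from x s].
Proof. by elim: s x => //= s st IHst x; rewrite addrAC IHst. Qed.

Lemma walk_from_translate x s : walk_from x s = [seq v + x | v <- walk_from 0 s].
Proof. by rewrite -walk_from_add add0r. Qed.

Lemma uniq_walk_from x s : uniq (walk_from x s) = uniq (walk_from 0 s).
Proof. by rewrite walk_from_translate map_inj_uniq //; apply: addIr. Qed.

Definition opp_step (s : step) : step := (s.1, ~~ s.2).

Lemma opp_stepK : involutive opp_step.
Proof. by case=> i b; rewrite /opp_step negbK. Qed.

Lemma step_vec_opp (s : step) : step_vec (opp_step s) = - step_vec s.
Proof.
apply/ffunP => i; rewrite !ffunE /=; case: (i == s.1); last by rewrite oppr0.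
by case: s.2; rewrite /= ?opprK.
Qed.

Definition rev_walk s := rev (map opp_step s).

Lemma walk_from_rev x s :
  walk_from (endpoint x s) (rev_walk s) = rev (walk_from x s) /\
  endpoint (endpoint x s) (rev_walk s) = x.
Proof.
elim: s x => //= s st IHst x; have [IH1 IH2] := IHst (x + step_vec s).
rewrite /rev_walk map_cons rev_cons -cats1 walk_from_cat_behead endpoint_cat.
by rewrite IH1 IH2 /= step_vec_opp addrK rev_cons cats1.
Qed.

Definition halfspace_walk x s :=
  uniq (walk_from x s) && all (fun v => 0 <= ht v) (walk_from x s).

Definition visits_from x s := count (fun v => ht v == 0) (behead (walk_from x s)).

Lemma halfspace_walk_translate x s :
  halfspace_walk 0 s =
  uniq (walk_from x s) && all (fun v => ht x <= ht v) (walk_from x s).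
Proof.
rewrite uniq_walk_from /halfspace_walk (walk_from_translate x) all_map.
by congr (_ && _); apply: eq_all => v /=; rewrite htD lerDr.
Qed.

Lemma visits_from_translate x s : ht x = 0 -> visits_from x s = visits_from 0 s.
Proof.
move=> x0; rewrite /visits_from (walk_from_translate x) behead_map count_map.
by apply: eq_count => v /=; rewrite htD x0 addr0.
Qed.

Lemma halfspace_walk_cat x s t : halfspace_walk x (s ++ t) ->
  halfspace_walk x s /\ halfspace_walk (endpoint x s) t.
Proof.
move=> /andP[u a]; split; apply/andP; split.
- by move: u; rewrite walk_from_cat_behead cat_uniq => /and3P[].
- by move: a; rewrite walk_from_cat_behead all_cat => /andP[].
- by move: u; rewrite walk_from_cat cat_uniq => /and3P[].
- by move: a; rewrite walk_from_cat all_cat => /andP[].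
Qed.

(** The junction is counted at the end of a nonempty first piece and dropped as the start of the
    second, so it is never counted twice. *)
Lemma visits_from_cat x s t :
  visits_from x (s ++ t) = (visits_from x s + visits_from (endpoint x s) t)%N.
Proof. by rewrite /visits_from walk_from_cat_behead; case: s => [|? ?] //=; rewrite count_cat. Qed.

Lemma size_walk_from x s : size (walk_from x s) = (size s).+1.
Proof. by elim: s x => //= s st IHst x; rewrite IHst. Qed.

Lemma visits_from_le x s : (visits_from x s <= size s)%N.
Proof. by rewrite /visits_from (leq_trans (count_size _ _)) // size_behead size_walk_from. Qed.

(** The prefix up to the first visit carries exactly one factor [a], and the rest starts on the
    boundary, hence can be translated to start at the origin. *)
Lemma first_visit x st : visits_from x st = 0%N \/
  exists s t, [/\ st = s ++ t, visits_from x s = 1%N & ht (endpoint x s) = 0].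
Proof.
elim: st x => [|s st IHst] x; first by left.
have visitsS t : visits_from x (s :: t) =
    ((ht (x + step_vec s) == 0)%R + visits_from (x + step_vec s)%R t)%N.
  by rewrite /visits_from; case: t.
case: (eqVneq (ht (x + step_vec s)) 0) => [b0|b0].
  by right; exists [:: s], st; rewrite visitsS b0 eqxx.
have [v0|[s' [t [-> v1 e0]]]] := IHst (x + step_vec s).
  by left; rewrite visitsS (negPf b0) v0.
by right; exists (s :: s'), t; rewrite visitsS (negPf b0) v1.
Qed.

Lemma lowest_point x st : exists s t, st = s ++ t /\
  all (fun v => ht (endpoint x s) <= ht v) (walk_from x st).
Proof.
elim: st x => [|s st IHst] x; first by exists [::], [::]; rewrite /= lexx.
have [s' [t [-> low]]] := IHst (x + step_vec s).
case: (lerP (ht (endpoint (x + step_vec s) s')) (ht x)) => [le_x|/ltW lt_x].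
  by exists (s :: s'), t; split=> //=; rewrite le_x.
exists [::], (s :: s' ++ t); split=> //=; rewrite lexx /=.
by apply: sub_all low => v; apply: le_trans.
Qed.

(* Cut at a lowest vertex: both halves, read outwards from it, stay in the
   half-space above it. *)
Lemma split_lowest st : uniq (walk_from 0 st) -> exists2 k, (k <= size st)%N &
  halfspace_walk 0 (rev_walk (take k st)) && halfspace_walk 0 (drop k st).
Proof.
move=> u; have [s [t [def_st low]]] := lowest_point 0 st.
exists (size s); first by rewrite def_st size_cat leq_addr.
rewrite def_st take_size_cat // drop_size_cat //.
rewrite !(halfspace_walk_translate (endpoint 0 s)) (walk_from_rev 0 s).1 rev_uniq all_rev.
have [u1 u2] : uniq (walk_from 0 s) /\ uniq (walk_from (endpoint 0 s) t).
  split; first by move: u; rewrite def_st walk_from_cat_behead cat_uniq => /and3P[].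
  by move: u; rewrite def_st walk_from_cat cat_uniq => /and3P[].
rewrite u1 u2 /=; apply/andP; split.
  by move: low; rewrite def_st walk_from_cat_behead all_cat => /andP[].
by move: low; rewrite def_st walk_from_cat all_cat => /andP[].
Qed.
End Walks.

(** * Partition functions and the inequalities obtained by cutting walks *)

Section PartitionFunctions.
Variables (R : realType) (d : nat).
Local Notation V := (vertex d.+1).
Local Notation step := ('I_d.+1 * bool)%type.
Implicit Types (x y v : V) (st s t : seq step) (a : R).

Definition saw_ind st : R := (uniq (walk_from 0 st))%:R.
Definition weight a x st : R := (halfspace_walk x st)%:R * a ^+ visits_from x st.
Definition saws n : R := tsum n saw_ind.
Definition Zhalf a n x : R := tsum n (weight a x).
(* Walks from every starting point of the half-space are allowed, so that the
   restriction of a walk to a time interval is again counted. *)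
Definition supZhalf a n : R := sup (range (Zhalf a n)).

Lemma saw_ind_ge0 st : 0 <= saw_ind st.
Proof. exact: ler0n. Qed.

Lemma weight_ge0 a x st : 0 <= a -> 0 <= weight a x st.
Proof. by move=> a0; rewrite mulr_ge0 ?ler0n ?exprn_ge0. Qed.

Lemma Zhalf_ge0 a n x : 0 <= a -> 0 <= Zhalf a n x.
Proof. by move=> a0; apply: tsum_ge0 => t; apply: weight_ge0. Qed.

Lemma saw_ind_cat s t : saw_ind (s ++ t) <= saw_ind s * saw_ind t.
Proof.
rewrite /saw_ind; case: (boolP (uniq (walk_from 0 (s ++ t)))) => [u|_]; last first.
  by rewrite -natrM ler0n.
have -> : uniq (walk_from 0 s).
  by move: u; rewrite walk_from_cat_behead cat_uniq => /and3P[].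
have -> : uniq (walk_from 0 t); last by rewrite mulr1.
rewrite -(uniq_walk_from (endpoint 0 s)).
by move: u; rewrite walk_from_cat cat_uniq => /and3P[].
Qed.

Lemma weight_cat a x s t : 0 <= a ->
  weight a x (s ++ t) <= weight a x s * weight a (endpoint x s) t.
Proof.
move=> a0; rewrite /weight.
case: (boolP (halfspace_walk x (s ++ t))) => [/halfspace_walk_cat[-> ->]|_].
  by rewrite visits_from_cat exprD !mul1r.
by rewrite mul0r mulr_ge0 // mulr_ge0 ?ler0n ?exprn_ge0.
Qed.

Lemma weight1_le_saw x st : weight 1 x st <= saw_ind st.
Proof.
rewrite /weight expr1n mulr1 /saw_ind ler_nat -(uniq_walk_from x).
by rewrite /halfspace_walk; case: uniq => //=; case: all.
Qed.

Lemma weight_translate a x st : ht x = 0 -> weight a x st = weight a 0 st.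
Proof.
move=> x0; rewrite /weight visits_from_translate // (halfspace_walk_translate x).
by rewrite /halfspace_walk x0.
Qed.

Lemma saws_sub m n : saws (m + n) <= saws m * saws n.
Proof.
rewrite /saws tsum_cat -tsum_mulr; apply: ler_tsum => s _.
by rewrite -tsum_mull; apply: ler_tsum => t _; apply: saw_ind_cat.
Qed.

Lemma Zhalf1_le_saws n x : Zhalf 1 n x <= saws n.
Proof. by apply: ler_tsum => t _; apply: weight1_le_saw. Qed.

Lemma Zhalf1_cat_le m n x : Zhalf 1 (m + n) x <= Zhalf 1 m x * saws n.
Proof.
rewrite /Zhalf /saws tsum_cat -tsum_mulr; apply: ler_tsum => s _.
rewrite -tsum_mull; apply: ler_tsum => t _.
apply: le_trans (weight_cat x s t ler01) _.
by apply: ler_wpM2l; [apply: weight_ge0|apply: weight1_le_saw].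
Qed.

(** A walk of length [n] has weight at most [max(1, a)^n] whatever its starting point, so [supZhalf]
    is a genuine supremum and not a default value. *)
Lemma Zhalf_has_sup a n : 0 <= a -> has_sup (range (Zhalf a n)).
Proof.
move=> a0; split; first by exists (Zhalf a n 0), 0.
exists (tsum n (fun _ : seq step => (Num.max 1 a) ^+ n)) => _ [x _ <-].
have m1 : 1 <= Num.max 1 a by rewrite le_max lexx.
apply: ler_tsum => t tn; rewrite /weight.
apply: le_trans (_ : 1 * Num.max 1 a ^+ visits_from x t <= _).
  apply: ler_pM; rewrite ?ler0n ?exprn_ge0 ?lern1 ?leq_b1 //.
  by rewrite lerXn2r // ?nnegrE ?le_max ?lexx ?ler01 ?orbT.
by rewrite mul1r ler_weXn2l // -tn visits_from_le.
Qed.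

Lemma Zhalf_le_supZhalf a n x : 0 <= a -> Zhalf a n x <= supZhalf a n.
Proof. by move=> a0; apply: sup_upper_bound; [apply: Zhalf_has_sup|exists x]. Qed.

Lemma supZhalf_le a n c : (forall x, Zhalf a n x <= c) -> supZhalf a n <= c.
Proof. by move=> h; apply: ge_sup => [|_ [x _ <-]] //; exists (Zhalf a n 0), 0. Qed.

Lemma supZhalf_ge0 a n : 0 <= a -> 0 <= supZhalf a n.
Proof. by move=> a0; apply: le_trans (Zhalf_le_supZhalf n 0 a0); apply: Zhalf_ge0. Qed.

Lemma Zhalf_cat_le a m n x : 0 <= a -> Zhalf a (m + n) x <= Zhalf a m x * supZhalf a n.
Proof.
move=> a0; rewrite /Zhalf tsum_cat -tsum_mulr; apply: ler_tsum => s _.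
apply: le_trans (_ : weight a x s * Zhalf a n (endpoint x s) <= _); last first.
  by apply: ler_wpM2l; [apply: weight_ge0|apply: Zhalf_le_supZhalf].
by rewrite /Zhalf -tsum_mull; apply: ler_tsum => t _; apply: weight_cat.
Qed.

Lemma supZhalf_sub a m n : 0 <= a -> supZhalf a (m + n) <= supZhalf a m * supZhalf a n.
Proof.
move=> a0; apply: supZhalf_le => x; apply: le_trans (Zhalf_cat_le m n x a0) _.
by apply: ler_wpM2r; [apply: supZhalf_ge0|apply: Zhalf_le_supZhalf].
Qed.

(** Cut each self-avoiding walk at a lowest vertex and sum over all cut times [k]. The first piece
    is read backwards, which does not change its sum. *)
Lemma saws_le_split n : saws n <= \sum_(k < n.+1) Zhalf 1 k 0 * Zhalf 1 (n - k) 0.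
Proof.
pose F k st := weight 1 0 (rev_walk (take k st)) * weight 1 0 (drop k st).
apply: le_trans (_ : tsum n (fun st => \sum_(k < n.+1) F k st) <= _).
  apply: ler_tsum => st sz; rewrite /saw_ind.
  have F0 k : 0 <= F k st by rewrite mulr_ge0 ?weight_ge0 ?ler01.
  case: (boolP (uniq _)) => [/split_lowest[k kn /andP[h1 h2]]|_]; last by rewrite sumr_ge0.
  rewrite sz -ltnS in kn; rewrite (bigD1 (Ordinal kn)) //= ler_wpDr ?sumr_ge0 //.
  by rewrite /F /weight h1 h2 !expr1n !mulr1.
rewrite tsum_exchange; apply: ler_sum => k _.
rewrite /F (tsum_take_drop (fun s => weight 1 0 (rev_walk s)) (weight 1 0)); last by rewrite -ltnS.
by rewrite /Zhalf -[tsum k (weight 1 0)](tsum_rev_map k _ (@opp_stepK d)).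
Qed.

(** A walk without visits is counted by [saws n]. Otherwise the prefix up to the first visit weighs
    at most [a] times its self-avoidance indicator, and the suffix is translated to the origin. *)
Lemma Zhalf_le_first_visit a n x : 0 <= a ->
  Zhalf a n x <= saws n + a * \sum_(k < n.+1) saws k * Zhalf a (n - k) 0.
Proof.
move=> a0; pose F k st := saw_ind (take k st) * weight a 0 (drop k st).
apply: le_trans (_ : tsum n (fun st => saw_ind st + a * \sum_(k < n.+1) F k st) <= _).
  apply: ler_tsum => st sz.
  have F0 k : 0 <= F k st by rewrite mulr_ge0 ?saw_ind_ge0 ?weight_ge0.
  have [v0|[s [t [def_st v1 e0]]]] := first_visit x st.
    rewrite ler_wpDr ?mulr_ge0 ?sumr_ge0 //.
    by apply: le_trans (weight1_le_saw x st); rewrite /weight v0 !expr0.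
  rewrite ler_wpDl ?saw_ind_ge0 //.
  have sn : (size s < n.+1)%N by rewrite ltnS -sz def_st size_cat leq_addr.
  apply: le_trans (_ : a * F (size s) st <= _); last first.
    rewrite ler_wpM2l // (bigD1 (Ordinal sn)) //= ler_wpDr ?sumr_ge0 //.
  rewrite /F def_st take_size_cat // drop_size_cat // -(weight_translate a t e0) mulrA.
  apply: le_trans (weight_cat x s t a0) _; apply: ler_wpM2r; first exact: weight_ge0.
  rewrite /weight v1 expr1 mulrC; apply: ler_wpM2l => //.
  by apply: le_trans (weight1_le_saw x s); rewrite /weight expr1n mulr1.
rewrite tsumD tsum_mull lerD2l; apply: ler_wpM2l => //.
rewrite tsum_exchange; apply: ler_sum => k _.
by rewrite /F tsum_take_drop // -ltnS.
Qed.

(** Prefixing an upward step lifts the walk strictly above the boundary: it makes no visit, so its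
    weight is 1 for every [a]. *)
Lemma Zhalf_step_up a n : 0 <= a -> Zhalf 1 n 0 <= Zhalf a n.+1 0.
Proof.
move=> a0; pose up : step := (ord_max, true).
rewrite /Zhalf [leRHS]/= (bigD1 up) //= ler_wpDr ?sumr_ge0 //.
  by move=> s _; apply: tsum_ge0 => t; apply: weight_ge0.
have ht_up : ht (step_vec up) = 1 by rewrite /ht ffunE /= eqxx.
apply: ler_tsum => t _; rewrite /weight expr1n mulr1.
case: (boolP (halfspace_walk 0 t)) => [/andP[u h]|_]; last first.
  by rewrite mulr_ge0 ?ler0n ?exprn_ge0.
have low : all (fun v => 1 <= ht v) (walk_from (step_vec up) t).
  rewrite walk_from_translate all_map; apply: sub_all h => v /=.
  by rewrite htD ht_up lerDr.
have -> : visits_from 0 (up :: t) = 0%N.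
  apply/eqP; rewrite /visits_from /= add0r -leqn0 leqNgt -has_count -all_predC.
  by apply: sub_all low => v /=; case: eqP => // ->.
rewrite expr0 mulr1 ler_nat lt0b /halfspace_walk /= add0r uniq_walk_from u !andbT.
apply/and3P; split.
- by apply/negP => /(allP low); rewrite /ht ffunE.
- by rewrite /ht ffunE.
- by apply: sub_all low => v; apply: le_trans.
Qed.

Lemma Zhalf0 a : Zhalf a 0 0 = 1.
Proof. by rewrite /Zhalf /= /weight /halfspace_walk /= /ht ffunE lexx mulr1. Qed.

Lemma Zhalf1_ge1 n : 1 <= Zhalf 1 n 0.
Proof. by elim: n => [|n /le_trans]; [rewrite Zhalf0|apply; apply: Zhalf_step_up]. Qed.

Lemma Zhalf_ge1 a n : 0 <= a -> 1 <= Zhalf a n 0.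
Proof.
move=> a0; case: n => [|n]; first by rewrite Zhalf0.
by apply: le_trans (Zhalf1_ge1 n) _; apply: Zhalf_step_up.
Qed.

Lemma Zhalf_mono a b n x : 0 <= a -> a <= b -> Zhalf a n x <= Zhalf b n x.
Proof.
move=> a0 ab; apply: ler_tsum => t _; apply: ler_wpM2l; rewrite ?ler0n //.
by rewrite lerXn2r // nnegrE // (le_trans a0).
Qed.

(** A walk of length [n] makes at most [n] visits, each changing its weight by the factor
    [b / a >= 1]. *)
Lemma Zhalf_scale a b n x : 0 < a -> a <= b -> Zhalf b n x <= (b / a) ^+ n * Zhalf a n x.
Proof.
move=> a0 ab; rewrite /Zhalf -tsum_mull; apply: ler_tsum => t tn.
rewrite /weight mulrCA; apply: ler_wpM2l; rewrite ?ler0n //.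
have -> : b ^+ visits_from x t = (b / a) ^+ visits_from x t * a ^+ visits_from x t.
  by rewrite -exprMn divfK // gt_eqF.
apply: ler_wpM2r; first by rewrite exprn_ge0 // ltW.
by rewrite ler_weXn2l ?ler_pdivlMr ?mul1r // -tn visits_from_le.
Qed.

Lemma saws0 : saws 0 = 1.
Proof. by rewrite /saws /= /saw_ind. Qed.

Lemma saws_ge1 n : 1 <= saws n.
Proof. exact: le_trans (Zhalf1_ge1 n) (Zhalf1_le_saws n 0). Qed.

Lemma supZhalf_ge1 a n : 0 <= a -> 1 <= supZhalf a n.
Proof. by move=> a0; apply: le_trans (Zhalf_ge1 n a0) (Zhalf_le_supZhalf n 0 a0). Qed.

Lemma supZhalf0 a : 0 <= a -> supZhalf a 0 = 1.
Proof.
move=> a0; apply/eqP; rewrite eq_le supZhalf_ge1 // andbT; apply: supZhalf_le => x.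
by rewrite /Zhalf /= /weight /visits_from expr0 mulr1 lern1 leq_b1.
Qed.

Lemma saw_countE n : (saw_count d.+1 n)%:R = saws n.
Proof.
rewrite /saws tsumE /saw_count -sum1_card natr_sum.
rewrite big_mkcond; apply: eq_bigr => st _.
by rewrite /saw_ind inE /is_saw walk_verticesE; case: uniq.
Qed.

(** Walks are grouped by their number of visits, which is at most [n], so each walk falls in exactly
    one class. *)
Lemma Aplus_nE a n : Aplus_n d.+1 n a = Zhalf a n 0.
Proof.
rewrite /Aplus_n /Zhalf tsumE.
have cE (v : 'I_n.+1) : (cplus d.+1 n v)%:R * a ^+ v =
    \sum_(st : n.-tuple step) (if visits_from 0 st == v then weight a 0 st else 0).
  rewrite /cplus -sum1_card natr_sum mulr_suml big_mkcond; apply: eq_bigr => st _.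
  rewrite inE /is_positive_walk /is_saw /visits walk_verticesE.
  rewrite (eq_all (@in_halfE d)) (eq_count (@on_boundaryE d)) -/(halfspace_walk _ _).
  rewrite -/(visits_from 0 st) /weight.
  case: eqP => [->|_]; last by rewrite andbF.
  by rewrite andbT; case: halfspace_walk; rewrite ?mul1r ?mul0r.
under eq_bigr do rewrite cE; rewrite exchange_big; apply: eq_bigr => st _.
have vn : (visits_from (0%R : V) st < n.+1)%N by rewrite ltnS -{2}(size_tuple st) visits_from_le.
rewrite (bigD1 (Ordinal vn)) //= eqxx big1 ?addr0 // => i iv; case: eqP => // e.
by case/eqP: iv; apply: val_inj.
Qed.
End PartitionFunctions.

(** * Growth of the partition functions *)

Lemma subn_double_le i k : (k <= i)%N -> (2 * i - k)%N = (i + (i - k))%N.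
Proof. by lia. Qed.

Lemma subn_double_ge i k : (i <= k <= 2 * i)%N -> i = ((k - i) + (2 * i - k))%N.
Proof. by lia. Qed.

Lemma leq_sub_double i k : (i < k)%N -> (2 * i - k <= i)%N.
Proof. by lia. Qed.

Section Rates.
Variables (R : realType) (d : nat).
Implicit Types (a m l : R).
Local Notation saws := (@saws R d).
Local Notation Zorigin a := (fun n => Zhalf a n (0 : vertex d.+1)).

(** In each product given by [saws_le_split] at length [2 j], the longer factor is cut at time [j];
    the leftover pieces have total length [j] and cost about [m ^ j]. *)
Lemma growth_ge_Zhalf1 m : 0 < m -> growth saws m -> growth_ge (Zorigin 1) m.
Proof.
move=> m0 [gle gge].
have P0 n : 0 <= Zhalf 1 n (0 : vertex d.+1) :> R by apply: Zhalf_ge0; apply: ler01.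
apply: (growth_ge_of_double m0 gge P0) => r r0 r1.
have [t [t0 t1 rt]] := exists_root_between 3 r0 r1.
have [K K0 hK] := gle t t0 t1; have [L L0 hL] := succ_mul_exp_le t0 t1.
(* The rate [e = m / t] exceeds [m] slightly, which turns the bound on [saws] into a clean geometric
   one. *)
have [e e0 me] : exists2 e, 0 < e & m = e * t.
  by exists (m / t); [rewrite divr_gt0|rewrite divfK // gt_eqF].
have cle n : saws n <= K * e ^+ n.
  by rewrite -(ler_pM2r (exprn_gt0 n t0)) -mulrA -exprMn -me mulrC.
have c0 n : 0 <= saws n by rewrite (le_trans ler01) // saws_ge1.
have Ke n : 0 <= K * e ^+ n by rewrite mulr_ge0 ?exprn_ge0 // ltW.
exists (K ^+ 2 * L) => [|j]; first by rewrite mulr_gt0 // exprn_gt0.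
set P := fun n => Zhalf 1 n (0 : vertex d.+1) : R.
have Pmul k : (k <= j)%N -> P (2 * j - k)%N * P k <= K ^+ 2 * e ^+ j * P j.
  move=> kj; rewrite subn_double_le //.
  apply: le_trans (_ : (P j * (K * e ^+ (j - k))) * (K * e ^+ k) <= _).
    apply: ler_pM; rewrite /P //.
      apply: le_trans (Zhalf1_cat_le _ _ _ _) _; exact: ler_wpM2l.
    by apply: le_trans (Zhalf1_le_saws _ _ _) _.
  rewrite -{3}(subnK kj) exprD le_eqVlt; apply/orP; left; apply/eqP; ring.
have csum : saws (2 * j) <= (2 * j).+1%:R * (K ^+ 2 * e ^+ j * P j).
  apply: le_trans (saws_le_split _ _ _) _.
  rewrite mulr_natl -[X in _ *+ X]card_ord -sumr_const ler_sum // => k _.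
  have k2 : (k <= 2 * j)%N by rewrite -ltnS.
  case: (leqP k j) => kj; first by rewrite mulrC; apply: Pmul.
  have -> : Zhalf 1 k (0 : vertex d.+1) = P (2 * j - (2 * j - k))%N by rewrite subKn.
  by apply: Pmul; apply: leq_sub_double.
have tj : 0 < t ^+ j by rewrite exprn_gt0.
(* One factor [t ^ j] turns [e ^ j] back into [m ^ j]; the other two absorb the [2 j + 1] terms. *)
apply: le_trans (_ : t ^+ j ^+ 3 * saws (2 * j) <= _).
  apply: ler_wpM2r => //; rewrite -exprM mulnC exprM.
  by rewrite lerXn2r // nnegrE ?exprn_ge0 // ltW.
have tj3 : 0 <= t ^+ j ^+ 3 by rewrite exprn_ge0 // ltW.
apply: le_trans (ler_wpM2l tj3 csum) _.
have -> : t ^+ j ^+ 3 * ((2 * j).+1%:R * (K ^+ 2 * e ^+ j * P j)) =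
    K ^+ 2 * (m ^+ j * P j) * ((2 * j).+1%:R * t ^+ (2 * j)).
  by rewrite me exprMn mulnC exprM; ring.
have -> : K ^+ 2 * L * (m ^+ j * P j) = K ^+ 2 * (m ^+ j * P j) * L by ring.
by apply: ler_wpM2l; rewrite // !mulr_ge0 ?exprn_ge0 // ?P0 // ltW.
Qed.

(** [Zhalf_step_up] transfers the bound from weight 1 to weight [a]. The shift of length costs the
    factor [m], and the summand 1 in the constant covers [n = 0]. *)
Lemma growth_ge_Zhalf a m : 0 < a -> 0 < m -> growth saws m -> growth_ge (Zorigin a) m.
Proof.
move=> a0 m0 gm s s0 s1; have [K K0 h] := growth_ge_Zhalf1 m0 gm s0 s1.
exists (1 + m * K) => [|n]; first by rewrite addr_gt0 // mulr_gt0.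
have mK : 0 < m * K by rewrite mulr_gt0.
case: n => [|n]; first by rewrite Zhalf0 !expr0 !mulr1 lerDl ltW.
have Zn : 0 <= Zhalf a n.+1 (0 : vertex d.+1) by rewrite Zhalf_ge0 // ltW.
apply: le_trans (_ : m * K * Zhalf a n.+1 0 <= _); last by apply: ler_wpM2r; rewrite // lerDr.
apply: le_trans (_ : m * (K * Zhalf 1 n 0) <= _); last first.
  by rewrite mulrA; apply: ler_wpM2l; [apply: ltW|apply: Zhalf_step_up; apply: ltW].
have := ler_wpM2l (ltW m0) (h n); apply: le_trans.
have x0 : 0 <= m * (s ^+ n * m ^+ n) by rewrite !mulr_ge0 ?exprn_ge0 // ltW.
have -> : s ^+ n.+1 * m ^+ n.+1 = s * (m * (s ^+ n * m ^+ n)) by rewrite !exprS; ring.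
by rewrite ler_piMl // ltW.
Qed.

(** The rate [l] is that of [supZhalf], which bounds [Zhalf] from above. For the lower bound, every
    term of the first-visit decomposition at length [2 i] is compared with [l ^ i * Zhalf a i 0]. *)
Lemma growth_Zhalf a m : 0 < a -> 0 < m -> growth saws m ->
  exists l, [/\ 0 < l, m <= l & growth (Zorigin a) l].
Proof.
move=> a0 m0 gm; have a0' := ltW a0.
have [l l0 [gle gge]] := submultiplicative_growth (fun n => supZhalf_ge1 d n a0') (supZhalf0 d a0')
  (fun i j => supZhalf_sub d i j a0').
have Zle n : Zhalf a n (0 : vertex d.+1) <= supZhalf d a n by apply: Zhalf_le_supZhalf.
have Zgle : growth_le (Zorigin a) l by apply: growth_le_mono gle.
have Zge := growth_ge_Zhalf a0 m0 gm.
have ml : m <= l by apply: growth_rate_le Zge.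
have A0 n : 0 <= Zhalf a n (0 : vertex d.+1) by apply: Zhalf_ge0.
exists l; split=> //; split=> //.
apply: (growth_ge_of_double l0 gge A0) => r r0 r1.
have [t [t0 t1 rt]] := exists_root_between 5 r0 r1.
have [gmle _] := gm.
have [K1 K10 h1] := gmle t t0 t1; have [K2 K20 h2] := gle t t0 t1.
have [K3 K30 h3] := Zge t t0 t1; have [L L0 hL] := succ_mul_exp_le t0 t1.
(* All losses are written as powers of [w = 1 / t >= 1], and one constant [K] serves for all the
   bounds. *)
have [w w0 wt] : exists2 w, 0 < w & w * t = 1.
  by exists t^-1; [rewrite invr_gt0|rewrite mulVf // gt_eqF].
have w1 : 1 <= w.
  by rewrite leNgt; apply/negP => wlt; have : w * t < 1; [rewrite mulr_ilt1 ?ltW|rewrite wt ltxx].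
have [K [K_ge1 K1K K2K K3K]] : exists K : R, [/\ 1 <= K, K1 <= K, K2 <= K & K3 <= K].
  by exists (1 + K1 + K2 + K3); split; lra.
have K0 : 0 < K by apply: lt_le_trans K_ge1.
have cancel (x y : R) n : t ^+ n * x <= y -> x <= y * w ^+ n.
  move=> h; have -> : x = t ^+ n * x * w ^+ n.
    by rewrite mulrAC -exprMn mulrC (mulrC t) wt expr1n mulr1.
  by apply: ler_wpM2r; rewrite // exprn_ge0 // ltW.
have lw0 : 0 < l * w by rewrite mulr_gt0.
have mw0 : 0 < m * w by rewrite mulr_gt0.
have cle n : saws n <= K * (m * w) ^+ n.
  apply: le_trans (cancel _ _ _ (h1 n)) _; rewrite -mulrA -exprMn.
  by apply: ler_wpM2r; rewrite // exprn_ge0 // ltW.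
have mlw : m * w <= l * w by apply: ler_wpM2r; rewrite // ltW.
have cle' n : saws n <= K * (l * w) ^+ n.
  apply: le_trans (cle n) _; apply: ler_wpM2l; first exact: ltW.
  by rewrite lerXn2r // nnegrE ltW.
have Dle n : supZhalf d a n <= K * (l * w) ^+ n.
  apply: le_trans (cancel _ _ _ (h2 n)) _; rewrite -mulrA -exprMn.
  by apply: ler_wpM2r; rewrite // exprn_ge0 // ltW.
have Age n : m ^+ n <= K * w ^+ n * Zhalf a n (0 : vertex d.+1).
  apply: le_trans (cancel _ _ _ (h3 n)) _; rewrite mulrAC.
  by apply: ler_wpM2r; rewrite // ler_wpM2r // exprn_ge0 // ltW.
exists ((1 + a) * K ^+ 3 * L) => [|i].
  by rewrite !mulr_gt0 ?exprn_gt0 // addr_gt0.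
set A := fun n => Zhalf a n (0 : vertex d.+1).
pose B := K ^+ 3 * (l * w ^+ 3) ^+ i * A i.
have c0 n : 0 <= saws n by rewrite (le_trans ler01) // saws_ge1.
(* First visit after time [i]: trading the excess [k - i] from rate [m] to the larger rate [l]
   leaves [m ^ i * l ^ i], and [m ^ i] is bounded through [Age] by [A i]. *)
have far k : (i <= k <= 2 * i)%N ->
    K ^+ 2 * ((m * w) ^+ k * (l * w) ^+ (2 * i - k)) <= B.
  move=> /andP[ik k2]; rewrite /B.
  apply: le_trans (_ : K ^+ 2 * ((m * w) ^+ i * (l * w) ^+ i) <= _).
    apply: ler_wpM2l; first by rewrite exprn_ge0 // ltW.
    have -> : (m * w) ^+ k = (m * w) ^+ i * (m * w) ^+ (k - i) by rewrite -exprD subnKC.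
    have -> : (l * w) ^+ i = (l * w) ^+ (k - i) * (l * w) ^+ (2 * i - k).
      by rewrite -exprD; congr (_ ^+ _); apply: subn_double_ge; rewrite ik.
    rewrite -mulrA; apply: ler_wpM2l; first by rewrite exprn_ge0 // ltW.
    apply: ler_wpM2r; first by rewrite exprn_ge0 // ltW.
    by rewrite lerXn2r // nnegrE ltW.
  have -> : K ^+ 2 * ((m * w) ^+ i * (l * w) ^+ i) = K ^+ 2 * (l * w ^+ 2) ^+ i * m ^+ i.
    by rewrite !exprMn; ring.
  have -> : K ^+ 3 * (l * w ^+ 3) ^+ i * A i =
     K ^+ 2 * (l * w ^+ 2) ^+ i * (K * w ^+ i * A i).
    by rewrite !exprMn; ring.
  by apply: ler_wpM2l (Age i); rewrite !mulr_ge0 ?exprn_ge0 ?mulr_ge0 ?exprn_ge0 // ltW.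
(* First visit by time [i]: the remaining walk is cut after [i] steps, leaving [A i] times pieces of
   total length [i], each of rate at most [l]. *)
have near k : (k <= i)%N -> saws k * A (2 * i - k)%N <= B.
  move=> ki; rewrite subn_double_le //.
  apply: le_trans (_ : K * (l * w) ^+ k * (A i * (K * (l * w) ^+ (i - k))) <= _).
    apply: ler_pM => //; first exact: A0.
    by apply: le_trans (Zhalf_cat_le _ _ _ a0') _; apply: ler_wpM2l.
  have -> : K * (l * w) ^+ k * (A i * (K * (l * w) ^+ (i - k))) =
      K ^+ 2 * (l * w) ^+ i * A i.
    have -> : (l * w) ^+ i = (l * w) ^+ k * (l * w) ^+ (i - k) by rewrite -exprD subnKC.
    by ring.
  rewrite /B; apply: ler_wpM2r; first exact: A0.
  apply: ler_pM; rewrite ?exprn_ge0 ?(ltW K0) ?(ltW lw0) //.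
    by rewrite ler_weXn2l.
  rewrite lerXn2r // ?nnegrE ?mulr_ge0 ?exprn_ge0 ?(ltW l0) ?(ltW w0) //.
  by rewrite ler_wpM2l ?(ltW l0) // -{1}(expr1 w) ler_weXn2l.
have term k : (k <= 2 * i)%N -> saws k * A (2 * i - k)%N <= B.
  move=> k2; case: (leqP k i) => [/near //|/ltnW ik].
  apply: le_trans (far k _); last by rewrite ik.
  apply: le_trans (_ : K * (m * w) ^+ k * (K * (l * w) ^+ (2 * i - k)) <= _).
    by apply: ler_pM => //; [exact: A0|apply: le_trans (Zle _) (Dle _)].
  by rewrite le_eqVlt; apply/orP; left; apply/eqP; ring.
(* Walks without visits are handled like a first visit at the final time [2 i]. *)
have term0 : saws (2 * i) <= B.
  apply: le_trans (far (2 * i)%N _); last by rewrite leqnn andbT leq_pmull.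
  rewrite subnn mulr1; apply: le_trans (cle _) _.
  apply: ler_wpM2r; first by rewrite exprn_ge0 // ltW.
  by rewrite expr2 ler_peMl // ltW.
have B0 : 0 <= B by apply: le_trans term0.
have Dsum : supZhalf d a (2 * i) <= (1 + a) * (2 * i).+1%:R * B.
  apply: supZhalf_le => x; apply: le_trans (Zhalf_le_first_visit _ _ a0') _.
  apply: le_trans (_ : B + a * ((2 * i).+1%:R * B) <= _).
    apply: lerD => //; apply: ler_wpM2l => //.
    rewrite mulr_natl -[X in _ *+ X]card_ord -sumr_const ler_sum // => k _.
    by apply: term; rewrite -ltnS.
  have : 0 <= (2 * i)%:R * B by rewrite mulr_ge0 ?ler0n.
  by rewrite -natr1; lra.
have ti : 0 < t ^+ i by rewrite exprn_gt0.
(* Three of the five factors [t ^ i] cancel the [w ^ (3 i)] in [B]; two absorb the [2 i + 1]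
   terms. *)
apply: le_trans (_ : t ^+ i ^+ 5 * supZhalf d a (2 * i) <= _).
  apply: ler_wpM2r; first exact: supZhalf_ge0.
  by rewrite -exprM mulnC exprM lerXn2r // nnegrE ?exprn_ge0 // ltW.
have ti5 : 0 <= t ^+ i ^+ 5 by rewrite exprn_ge0 // ltW.
apply: le_trans (ler_wpM2l ti5 Dsum) _.
have -> : t ^+ i ^+ 5 * ((1 + a) * (2 * i).+1%:R * B) =
    (1 + a) * K ^+ 3 * (l ^+ i * A i) * ((2 * i).+1%:R * t ^+ (2 * i)).
  rewrite /B exprMn -[w ^+ 3 ^+ i]exprM ![(_ * i)%N]mulnC !exprM.
  have -> : t ^+ i ^+ 5 = t ^+ i ^+ 2 * t ^+ i ^+ 3 by rewrite -exprD.
  have wti : w ^+ i * t ^+ i = 1 by rewrite -exprMn wt expr1n.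
  have wti3 : t ^+ i ^+ 3 * w ^+ i ^+ 3 = 1 by rewrite -exprMn mulrC wti expr1n.
  rewrite -[RHS]mulr1 -wti3; ring.
have -> : (1 + a) * K ^+ 3 * L * (l ^+ i * A i) =
  (1 + a) * K ^+ 3 * (l ^+ i * A i) * L by ring.
have a1 : 0 <= 1 + a by rewrite addr_ge0.
by apply: ler_wpM2l (hL _); rewrite !mulr_ge0 ?exprn_ge0 ?(ltW K0) ?(ltW l0) // /A.
Qed.

End Rates.

(** * Identification of the growth rate with [lambda] *)

Section Lambda.
Variables (R : realType) (d : nat).
Implicit Types (a m l : R).
Local Notation saws := (@saws R d).
Local Notation Zorigin a := (fun n => Zhalf a n (0 : vertex d.+1)).

Lemma mu_growth m : 0 < m -> growth saws m -> mu d.+1 = m.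
Proof.
move=> m0 gm; rewrite /mu; apply: cvg_lim => //.
under eq_fun do rewrite saw_countE.
by apply: growth_root => // n; apply: lt_le_trans (saws_ge1 R d n).
Qed.

Lemma Aplus_growth a l : 0 < a -> 0 < l -> growth (Zorigin a) l -> Aplus d.+1 a = ln l.
Proof.
move=> a0 l0 gl; rewrite /Aplus; apply: cvg_lim => //.
under eq_fun do rewrite Aplus_nE.
by apply: growth_ln => // n; apply: lt_le_trans (Zhalf_ge1 d n (ltW a0)).
Qed.

(** Only [a <= a_crit] needs an argument. If the rate [l] at [a] exceeded [m], some [b] of rate [m]
    would satisfy [b > a m / l]. For [b >= a] monotonicity gives [l <= m]; for [b <= a] scaling
    gives [l <= (a / b) m < l]. *)
Lemma lambda_growth a : 0 < a -> 0 < lambda d.+1 a /\ growth (Zorigin a) (lambda d.+1 a).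
Proof.
move=> a0; have [m m0 gm] := submultiplicative_growth (saws_ge1 R d) (saws0 R d) (@saws_sub R d).
have [l [l0 ml gl]] := growth_Zhalf a0 m0 gm.
rewrite /lambda (Aplus_growth a0 l0 gl) lnK // (mu_growth m0 gm).
case: ifPn => // a_le; suff -> : m = l by [].
apply/eqP; rewrite eq_le ml leNgt; apply/negP => ltml.
rewrite /a_crit (mu_growth m0 gm) in a_le.
set E := [set _ | _] in a_le.
(* Without a genuine supremum, [sup E] would take its default value 0, contradicting
   [0 < a <= sup E]. *)
have supE : has_sup E.
  by apply: contrapT => /sup_out E0; move: a_le; rewrite E0 leNgt a0.
have am : a * (m / l) < sup E.
  by apply: lt_le_trans a_le; rewrite gtr_pMr // ltr_pdivrMr // mul1r.
have [b [b0 Ab] ab] := sup_gt supE.1 am.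
have [l' [l'0 _ gl']] := growth_Zhalf b0 m0 gm.
have ? : l' = m.
  by apply: ln_inj; rewrite ?posrE // -Ab (Aplus_growth b0 l'0 gl').
subst l'.
case: (lerP a b) => [leab|/ltW leba].
  have : l <= m.
    apply: growth_rate_le gl.2 => //; apply: growth_le_mono gl'.1 => n.
    by apply: Zhalf_mono; rewrite // ltW.
  by rewrite leNgt ltml.
have : l <= a / b * m.
  apply: growth_rate_le gl.2 => //; first by rewrite mulr_gt0 ?divr_gt0.
  apply: growth_le_mono (growth_le_exp_mul _ gl'.1) => [n|]; first exact: Zhalf_scale.
  by rewrite divr_ge0 // ltW.
apply/negP; rewrite -ltNge mulrAC ltr_pdivrMr //.
by move: ab; rewrite mulrA ltr_pdivrMr // mulrC (mulrC b).
Qed.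
End Lambda.

Theorem theorem2p2 (R : realType) (d : nat) (a : R) :
  (2 <= d)%N -> 0 < a ->
  forall rho eps : R, 0 < rho -> rho < 1 -> 0 < eps ->
  exists N0 : nat, (1 <= N0)%N /\
    forall N : nat, (N0 <= N)%N ->
      `|1 - (nuN d N a rho)%:R / N%:R| < eps.
Proof.
case: d => // d _ a0 rho eps rho0 rho1 eps0.
have [l0 gl] := lambda_growth d a0.
pose b n := Aplus_n d.+1 n a / lambda d.+1 a ^+ n.
have b0 n : 0 < b n.
  by rewrite divr_gt0 ?exprn_gt0 // Aplus_nE (lt_le_trans ltr01) // Zhalf_ge1 // ltW.
have gb : growth b 1.
  have -> : b = (fun n => Zhalf a n (0 : vertex d.+1) / lambda d.+1 a ^+ n).
    by apply/funext => n; rewrite /b Aplus_nE.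
  exact: growth_scale.
have q0 : 0 < 1 - rho by rewrite subr_gt0.
have q1 : 1 - rho < 1 by rewrite gtrBl.
(* With [q = 1 - rho], the annulus in [nuN] is [in_annulus q]. *)
exact: zeros_near_circle b0 gb q0 q1 eps0.
Qed.
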